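(* Let $d$ and $\Delta$ be integers with $1\le d\le\Delta$. The maximum possible value of $q_B(G)$ among all finite simple $d$-degenerate graphs $G$ with maximum degree $\Delta(G)\le\Delta$ is $d\Delta$. Moreover, for every such graph $G$, the following are equivalent: (i) $q_B(G)=d\Delta$; (ii) $G$ contains a copy of $K_{d,\Delta}$; (iii) $G$ has at least $d$ vertices of degree $\Delta$ with the same open neighborhood.
   Context: A $B$-coloring of a graph $G$ is a proper edge-coloring (incident edges receive distinct colors) in which the edges of every $4$-cycle receive four distinct colors; $q_B(G)$ is the minimum number of colors in a $B$-coloring of $G$. A graph is $d$-degenerate if every nonempty subgraph has a vertex of degree at most $d$ (in that subgraph). ''Contains a copy of $K_{a,b}$'' means contains a subgraph, not necessarily induced, isomorphic to the complete bipartite graph $K_{a,b}$. $\Delta(G)$ denotes the maximum degree of $G$. *)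

(* Defs.v *)
From HB Require Import structures.
From mathcomp Require Import all_boot.

Set Implicit Arguments.
Unset Strict Implicit.
Unset Printing Implicit Defensive.

Record sgraph := SGraph {
  vertex :> finType;
  adj : rel vertex;
  adj_sym : symmetric adj;
  adj_irr : irreflexive adj }.

Arguments adj {s} x y.

Definition nbhd (G : sgraph) (x : G) : {set G} := [set y | adj x y].

Definition deg (G : sgraph) (x : G) : nat := #|nbhd x|.

Definition max_deg (G : sgraph) : nat := \max_(x : G) deg x.

Record subgraph (G : sgraph) := Subgraph {
  sub_vert : {set G};
  sub_adj : rel G;
  sub_adj_sym : symmetric sub_adj;
  sub_adj_adj : forall x y, sub_adj x y -> adj x y;
  sub_adj_vert : forall x y, sub_adj x y -> x \in sub_vert }.

Definition sub_deg (G : sgraph) (H : subgraph G) (x : G) : nat :=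
  #|[set y | sub_adj H x y]|.

Definition degenerate (d : nat) (G : sgraph) : Prop :=
  forall H : subgraph G, sub_vert H != set0 ->
    exists2 x, x \in sub_vert H & sub_deg H x <= d.

Definition contains_copy (G K : sgraph) : Prop :=
  exists (H : subgraph G) (phi : K -> G),
    [/\ injective phi,
        phi @: [set: K] = sub_vert H
      & forall x y : K, sub_adj H (phi x) (phi y) = adj x y].

Definition Kab_adj (a b : nat) (x y : 'I_a + 'I_b) : bool :=
  match x, y with
  | inl _, inr _ | inr _, inl _ => true
  | _, _ => false
  end.

Lemma Kab_adj_sym a b : symmetric (@Kab_adj a b).
Proof. by move=> [?|?] [?|?]. Qed.

Lemma Kab_adj_irr a b : irreflexive (@Kab_adj a b).
Proof. by case. Qed.

Definition Kab (a b : nat) : sgraph := SGraph (@Kab_adj_sym a b) (@Kab_adj_irr a b).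

(** Colorings are defined on the subtype of edges only (not on all vertex
    sets), so that an edgeless graph has a coloring with
    0 colors. *)

Definition edge_set (G : sgraph) : {set {set G}} :=
  [set [set p.1; p.2] | p in [pred p : G * G | adj p.1 p.2]].

Definition edge (G : sgraph) : finType := {e : {set G} | e \in edge_set G}.

Definition proper_coloring (G : sgraph) (k : nat) (c : {ffun edge G -> 'I_k}) : bool :=
  [forall e, forall f,
     (e != f) && (val e :&: val f != set0) ==> (c e != c f)].

Definition is_cycle4 (G : sgraph) (x y z w : G) : bool :=
  [&& uniq [:: x; y; z; w], adj x y, adj y z, adj z w & adj w x].

Definition cycle4_edges (G : sgraph) (x y z w : G) : {set {set G}} :=
  [set [set x; y]; [set y; z]; [set z; w]; [set w; x]].

Definition cycle4_rainbow (G : sgraph) (k : nat) (c : {ffun edge G -> 'I_k}) : bool :=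
  [forall x : G, forall y : G, forall z : G, forall w : G,
     is_cycle4 x y z w ==>
     [forall e, forall f,
        [&& val e \in cycle4_edges x y z w,
            val f \in cycle4_edges x y z w & e != f] ==> (c e != c f)]].

Definition B_coloring (G : sgraph) (k : nat) (c : {ffun edge G -> 'I_k}) : bool :=
  proper_coloring c && cycle4_rainbow c.

Definition B_colorable (G : sgraph) (k : nat) : bool :=
  [exists c : {ffun edge G -> 'I_k}, B_coloring c].

Lemma B_colorable_exists (G : sgraph) : exists k, B_colorable G k.
Proof.
exists #|edge G|; apply/existsP; exists [ffun e => enum_rank e].
apply/andP; split.
  apply/forallP=> e; apply/forallP=> f; apply/implyP=> /andP[nef _].
  by rewrite !ffunE (inj_eq enum_rank_inj).
do 4![apply/forallP=> ?]; apply/implyP=> _.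
apply/forallP=> e; apply/forallP=> f; apply/implyP=> /and3P[_ _ nef].
by rewrite !ffunE (inj_eq enum_rank_inj).
Qed.

Definition qB (G : sgraph) : nat := ex_minn (B_colorable_exists G).

Definition twins_of_degree (G : sgraph) (d D : nat) : Prop :=
  exists S : {set G},
    [/\ d <= #|S|,
        forall x, x \in S -> deg x = D
      & forall x y, x \in S -> y \in S -> nbhd x = nbhd y].

(* Main.v *)
Require Import Defs.
From HB Require Import structures.
From mathcomp Require Import all_boot.

Set Implicit Arguments.
Unset Strict Implicit.
Unset Printing Implicit Defensive.

(** Call two distinct edges conflicting if they meet or are opposite in a
    4-cycle; a B-coloring is a proper vertex coloring of the conflict graph.
    Given a nonempty set A of edges, let v be a vertex with at most d neighbors
    in the subgraph induced by the endpoints of A, let N be the set of these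
    neighbors, and let uv be an edge of A.  An edge of A conflicting with uv
    meets N, so there are at most d Delta - 1 of them, and greedy coloring
    yields q_B <= d Delta.  If this count is attained, the stars of the vertices
    of N are disjoint, have Delta edges each, and all their edges other than uv
    conflict with uv; this forces N to consist of d twins of degree Delta.
    Hence without twins d Delta - 1 colors suffice.  Conversely, all edges of
    K_{d,Delta} are pairwise conflicting. *)

(** * Greedy coloring and cardinalities of unions *)

Lemma greedy_coloring (T : finType) (r : rel T) (k : nat) :
  symmetric r -> irreflexive r ->
  (forall A : {set T}, A != set0 ->
     exists2 e, e \in A & #|[set f in A | r e f]| < k) ->
  exists c : {ffun T -> 'I_k}, forall e f, r e f -> c e != c f.
Proof.
move=> rsym rirr rdeg.
have [c cltk cP] : exists2 c : T -> nat, forall e, e \in [set: T] -> c e < k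
    & forall e f, e \in [set: T] -> f \in [set: T] -> r e f -> c e != c f.
  (* Generalized to every set [A] and proved by induction on its size: remove an element [e] with
     fewer than [k] neighbors in [A], color the rest, then give [e] a free color. *)
  move: [set: T] => A; have [n] := ubnP #|A|; elim: n A => // n IHn A leAn.
  have [-> | /rdeg[e eA few]] := eqVneq A set0.
    by exists (fun=> 0) => e; rewrite inE.
  have [|c cltk cP] := IHn (A :\ e).
    by move: leAn; rewrite (cardsD1 e) eA add1n ltnS.
  set s := [seq c f | f in [set f in A | r e f]].
  (* The colors of the neighbors of [e] are fewer than [k] in number, so they cannot exhaust
     [0, ..., k-1]. *)
  have /hasP[i ik iNs] : has [predC s] (iota 0 k).
    rewrite has_predC; apply: contraL few => /allP sub.
    by rewrite -leqNgt -(size_iota 0 k) -[#|_|](size_image c) uniq_leq_size ?iota_uniq.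
  move: ik; rewrite mem_iota add0n /= => ik.
  have free f : f \in A -> r e f -> i != c f.
    move=> fA ef; apply: contraNneq iNs => ->.
    by apply: image_f; rewrite inE fA.
  exists (fun f => if f == e then i else c f).
    by move=> f fA; case: ifPn => // fe; apply: cltk; rewrite !inE fe.
  move=> f g fA gA; case: ifPn => [/eqP-> | fe]; case: ifPn => [/eqP-> | ge].
  - by rewrite rirr.
  - exact: free.
  - by rewrite rsym eq_sym; apply: free.
  - by apply: cP; rewrite !inE ?fe ?ge.
exists [ffun e => Ordinal (cltk e (in_setT e))] => e f ref.
by rewrite !ffunE -val_eqE /= cP ?inE.
Qed.

Lemma card_bigcup_leq (T I : finType) (N : {set I}) (F : I -> {set T}) m :
  (forall y, y \in N -> #|F y| <= m) -> #|\bigcup_(y in N) F y| <= #|N| * m.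
Proof.
move=> Fm; rewrite -sum_nat_const.
elim/big_rec2: _ => [|y n B yN IH]; first by rewrite cards0.
by apply: leq_trans (leq_card_setU _ _) _; rewrite leq_add ?Fm.
Qed.

(** The sets other than [F y] cover at most [(#|N| - 1) * m] elements, so [F y] must have [m]
    elements outside all of them; having at most [m] in total, it meets none of them. *)
Lemma card_bigcup_tight (T I : finType) (N : {set I}) (F : I -> {set T}) d m :
  0 < m -> #|N| <= d -> (forall y, y \in N -> #|F y| <= m) ->
  d * m <= #|\bigcup_(y in N) F y| ->
  [/\ #|N| = d, forall y, y \in N -> #|F y| = m
    & forall y z, y \in N -> z \in N -> y != z -> F y :&: F z = set0].
Proof.
move=> m_gt0 Nd Fm dm.
have eqd : #|N| = d.
  apply/eqP; rewrite eqn_leq Nd -(leq_pmul2r m_gt0).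
  exact: leq_trans dm (card_bigcup_leq Fm).
have rest y : y \in N -> m <= #|F y :\: \bigcup_(z in N :\ y) F z|.
  move=> yN; set B := \bigcup_(z in _) _.
  have leB : #|B| <= #|N :\ y| * m.
    by apply: card_bigcup_leq => z; rewrite inE => /andP[_ /Fm].
  move: dm; rewrite (big_setD1 y yN) /= -eqd (cardsD1 y) yN mulSn -/B => dm.
  have UE : #|F y :|: B| = #|F y :\: B| + #|B|.
    apply: (@addIn #|F y :&: B|).
    by rewrite /= cardsUI -{1}(cardsID B (F y)) -addnA addnC.
  rewrite -(leq_add2r #|B|) -UE; apply: leq_trans dm.
  by rewrite leq_add2l.
have Fcard y : y \in N -> #|F y| = m.
  move=> yN; apply/eqP; rewrite eqn_leq Fm //=.
  exact: leq_trans (rest y yN) (subset_leq_card (subsetDl _ _)).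
split=> // y z yN zN nyz; apply/eqP; rewrite -cards_eq0 -leqn0.
have := rest y yN; rewrite -(Fcard y yN) -(cardsID (\bigcup_(t in N :\ y) F t)).
rewrite -{2}[#|_ :\: _|]add0n leq_add2r; apply: leq_trans.
apply: subset_leq_card; apply: setIS; apply: bigcup_sup.
by rewrite !inE eq_sym nyz.
Qed.

(** * Edges as vertex pairs and the conflict graph *)

Lemma set2_inj (T : finType) (a b x y : T) :
  [set a; b] = [set x; y] -> (a = x /\ b = y) \/ (a = y /\ b = x).
Proof.
move=> /setP eqs.
have /pred2P a_in : (a == x) || (a == y) by rewrite -in_set2 -eqs set21.
have /pred2P b_in : (b == x) || (b == y) by rewrite -in_set2 -eqs set22.
have /pred2P x_in : (x == a) || (x == b) by rewrite -in_set2 eqs set21.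
have /pred2P y_in : (y == a) || (y == b) by rewrite -in_set2 eqs set22.
by clear eqs; intuition congruence.
Qed.

Lemma edge_setP (G : sgraph) (e : {set G}) :
  reflect (exists x y, adj x y /\ e = [set x; y]) (e \in edge_set G).
Proof.
apply: (iffP imsetP) => [[[x y] /= xy ->]|[x [y [xy ->]]]].
  by exists x, y.
by exists (x, y).
Qed.

Lemma adj_edge_set (G : sgraph) (x y : G) : adj x y -> [set x; y] \in edge_set G.
Proof. by move=> xy; apply/edge_setP; exists x, y. Qed.

Lemma adj_neq (G : sgraph) (x y : G) : adj x y -> x != y.
Proof. by apply: contraTneq => ->; rewrite adj_irr. Qed.

(** The four vertices are not required to be distinct; the counting argument
    works for this larger relation. *)
Definition opposite (G : sgraph) (e f : {set G}) : bool :=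
  [exists x, exists y, exists z, exists w,
    [&& e == [set x; y], f == [set z; w], adj y z & adj w x]].

Definition conflict (G : sgraph) (e f : edge G) : bool :=
  (e != f) && ((val e :&: val f != set0) || opposite (val e) (val f)).

Lemma oppositeP (G : sgraph) (e f : {set G}) :
  reflect (exists x y z w, [/\ e = [set x; y], f = [set z; w], adj y z & adj w x])
    (opposite e f).
Proof.
apply: (iffP existsP) => [[x /existsP[y /existsP[z /existsP[w]]]]|].
  by case/and4P=> /eqP-> /eqP-> yz wx; exists x, y, z, w.
move=> [x [y [z [w [-> -> yz wx]]]]].
exists x; apply/existsP; exists y; apply/existsP; exists z; apply/existsP; exists w.
by rewrite !eqxx yz.
Qed.

Lemma opposite_sym (G : sgraph) : symmetric (@opposite G).
Proof.
have imp e f : @opposite G e f -> opposite f e.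
  move=> /oppositeP[x [y [z [w [-> -> yz wx]]]]].
  by apply/oppositeP; exists z, w, x, y.
by move=> e f; apply/idP/idP; apply: imp.
Qed.

Lemma conflict_sym (G : sgraph) : symmetric (@conflict G).
Proof. by move=> e f; rewrite /conflict eq_sym setIC opposite_sym. Qed.

Lemma conflict_irr (G : sgraph) : irreflexive (@conflict G).
Proof. by move=> e; rewrite /conflict eqxx. Qed.

(** Two distinct edges of a 4-cycle either share a vertex or are opposite, so they conflict in both
    cases. *)
Lemma conflict_B_coloring (G : sgraph) k (c : {ffun edge G -> 'I_k}) :
  (forall e f, conflict e f -> c e != c f) -> B_coloring c.
Proof.
move=> cP; apply/andP; split.
  apply/forallP=> e; apply/forallP=> f; apply/implyP=> /andP[ef meet].
  by rewrite cP // /conflict ef meet.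
apply/forallP=> x; apply/forallP=> y; apply/forallP=> z; apply/forallP=> w.
apply/implyP=> /and5P[_ xy yz zw wx].
apply/forallP=> e; apply/forallP=> f; apply/implyP=> /and3P[ein fin ef].
apply: cP; rewrite /conflict ef /=.
have meets a (A B : {set G}) : a \in A -> a \in B -> A :&: B != set0.
  by move=> aA aB; apply/set0Pn; exists a; rewrite inE aA.
have opp a b u v (A B : {set G}) : A = [set a; b] -> B = [set u; v] ->
    adj b u -> adj v a -> opposite A B.
  by move=> -> -> bu va; apply/oppositeP; exists a, b, u, v.
move: ein fin; rewrite !inE -!orbA.
case/or4P=> /eqP-> /or4P[] /eqP->; apply/orP;
  try by [right; apply: opp; first reflexivity; first reflexivity];
  left.
- by apply: (meets x); rewrite !inE eqxx ?orbT.
- by apply: (meets y); rewrite !inE eqxx ?orbT.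
- by apply: (meets x); rewrite !inE eqxx ?orbT.
- by apply: (meets y); rewrite !inE eqxx ?orbT.
- by apply: (meets y); rewrite !inE eqxx ?orbT.
- by apply: (meets z); rewrite !inE eqxx ?orbT.
- by apply: (meets z); rewrite !inE eqxx ?orbT.
- by apply: (meets z); rewrite !inE eqxx ?orbT.
- by apply: (meets w); rewrite !inE eqxx ?orbT.
- by apply: (meets x); rewrite !inE eqxx ?orbT.
- by apply: (meets w); rewrite !inE eqxx ?orbT.
- by apply: (meets w); rewrite !inE eqxx ?orbT.
Qed.

Lemma qB_leq (G : sgraph) k : B_colorable G k -> qB G <= k.
Proof. by rewrite /qB; case: ex_minnP => m _; apply. Qed.

Lemma qB_colorable (G : sgraph) : B_colorable G (qB G).
Proof. by rewrite /qB; case: ex_minnP. Qed.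

(** * The upper bound and its equality case *)

Lemma degenerate_induced (G : sgraph) d (S : {set G}) : degenerate d G -> S != set0 ->
  exists2 v, v \in S & #|[set y in S | adj v y]| <= d.
Proof.
move=> dG S0; pose a (x y : G) := [&& x \in S, y \in S & adj x y].
have asym : symmetric a by move=> x y; rewrite /a adj_sym andbCA.
have aadj x y : a x y -> adj x y by case/and3P.
have avert x y : a x y -> x \in S by case/and3P.
have [v vS] := dG (Subgraph asym aadj avert) S0.
rewrite /sub_deg /= => dv; exists v => //; apply: leq_trans dv.
by apply: subset_leq_card; apply/subsetP=> y; rewrite !inE /a vS.
Qed.

Definition star (G : sgraph) (y : G) : {set {set G}} :=
  [set [set y; x] | x in nbhd y].

Lemma card_star_leq (G : sgraph) (y : G) : #|star y| <= deg y.
Proof. exact: leq_imset_card. Qed.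

Lemma mem_star (G : sgraph) (y : G) (e : {set G}) :
  e \in edge_set G -> y \in e -> e \in star y.
Proof.
case/edge_setP=> a [b [ab ->]]; rewrite !inE => /pred2P[] ->.
  by apply/imsetP; exists b; rewrite ?inE.
by apply/imsetP; exists a; rewrite ?inE 1?adj_sym // setUC.
Qed.

Lemma deg_leq_max (G : sgraph) (x : G) : deg x <= max_deg G.
Proof. exact: (leq_bigmax x). Qed.

Lemma degenerate_conflict (G : sgraph) d D (A : {set edge G}) :
  0 < D -> degenerate d G -> max_deg G <= D -> A != set0 ->
  exists2 e, e \in A & let m := #|[set f in A | conflict e f]| in
    m < d * D /\ (d * D <= m.+1 -> twins_of_degree G d D).
Proof.
move=> D_gt0 dG maxD A0; set S := \bigcup_(e in A) val e.
have inS e x : e \in A -> x \in val e -> x \in S.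
  by move=> eA xe; apply/bigcupP; exists e.
have S0 : S != set0.
  have /set0Pn[e eA] := A0; have /edge_setP[x [y [_ exy]]] := valP e.
  by apply/set0Pn; exists x; apply: (inS e); rewrite // exy !inE eqxx.
have [v /bigcupP[e eA ve] dv] := degenerate_induced dG S0.
have /imsetP[u] := mem_star (valP e) ve; rewrite inE => vu evu.
set N := [set y in S | adj v y] in dv.
have uN : u \in N by rewrite inE vu (inS e) // evu !inE eqxx orbT.
have vN : v \notin N by rewrite inE adj_irr andbF.
exists e => //= {ve}; set C := [set f in A | _].
set U := \bigcup_(y in N) star y.
have starD y : y \in N -> #|star y| <= D.
  by move=> _; apply: leq_trans (card_star_leq y) (leq_trans (deg_leq_max y) maxD).
have cardU : #|U| <= d * D.
  by apply: leq_trans (card_bigcup_leq starD) _; rewrite leq_mul2r dv orbT.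
have eU : val e \in U.
  by apply/bigcupP; exists u; rewrite ?mem_star ?(valP e) // evu !inE eqxx orbT.
have CU : val @: C \subset U :\ val e.
  apply/subsetP=> _ /imsetP[f + ->]; rewrite inE => /and3P[fA ef efC].
  rewrite !inE (inj_eq val_inj) eq_sym ef /=.
  (* If [f] contains [u], take [u] itself; if [f] contains [v], its other end is in [N]; if [f] is
     opposite to [uv], the end of [f] joined to [v] is in [N]. *)
  suff [y yN yf] : exists2 y, y \in N & y \in val f.
    by apply/bigcupP; exists y; rewrite ?mem_star ?(valP f).
  case/orP: efC => [/set0Pn[t] | /oppositeP[x [y [z [w [exy fzw yz wx]]]]]].
    rewrite inE evu !inE => /andP[/pred2P[] -> tf]; last by exists u.
    have /imsetP[t'] := mem_star (valP f) tf; rewrite inE => vt' fvt'.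
    have t'f : t' \in val f by rewrite fvt' !inE eqxx orbT.
    by exists t'; rewrite // inE vt' (inS f).
  have [zf wf] : z \in val f /\ w \in val f by rewrite fzw !inE !eqxx orbT.
  have := esym exy; rewrite evu => /set2_inj[] [xE yE].
    by exists w; rewrite // inE (inS f) //= adj_sym -xE.
  by exists z; rewrite // inE (inS f) //= -yE.
have cardC : #|C| = #|val @: C| by rewrite card_imset //; apply: val_inj.
have cardU1 : #|U| = #|U :\ val e|.+1 by rewrite (cardsD1 (val e) U) eU.
split; first by rewrite cardC; apply: leq_ltn_trans (subset_leq_card CU) _; rewrite -cardU1.
move=> big.
have leU : d * D <= #|U| by rewrite cardU1 (leq_trans big) // ltnS cardC subset_leq_card.
have [Nd starE disj] := card_bigcup_tight D_gt0 dv starD leU.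
(* In the tight case the inclusion [CU] is an equality of sets: every edge meeting [N], other than
   [e], conflicts with [e]. *)
have UC : val @: C = U :\ val e.
  apply/eqP; rewrite eqEcard CU -ltnS -cardU1 -cardC.
  exact: leq_trans cardU big.
have degN y : y \in N -> deg y = D.
  move=> yN; apply/eqP; rewrite eqn_leq (leq_trans (deg_leq_max y)) //=.
  by rewrite -(starE y yN) card_star_leq.
(* An edge inside [N] would lie in the stars of both its ends, which are disjoint. *)
have indep y z : y \in N -> z \in N -> ~~ adj y z.
  move=> yN zN; apply/negP=> yz; have /setP/(_ [set y; z]) := disj y z yN zN (adj_neq yz).
  by rewrite !inE !mem_star ?adj_edge_set // !inE eqxx ?orbT.
(* For [y != u] the edge [yx] conflicts with [uv]. They can meet only if [x = v], which is adjacent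
   to [u]. If they are opposite, [u] is joined to [x] or to [y], and [indep] excludes [y]. *)
have sub y : y \in N -> nbhd y \subset nbhd u.
  move=> yN; have [-> // | yu] := eqVneq y u.
  apply/subsetP=> x; rewrite !inE => yx.
  have yv : y != v by apply: contraTneq yN => ->.
  have yxU : [set y; x] \in U :\ val e.
    rewrite !inE; apply/andP; split; last first.
      by apply/bigcupP; exists y; rewrite // mem_star ?adj_edge_set // !inE eqxx.
    apply/eqP=> yxe; have : y \in val e by rewrite -yxe !inE eqxx.
    by rewrite evu !inE (negPf yv) (negPf yu).
  move: yxU; rewrite -UC => /imsetP[f]; rewrite inE => /and3P[_ _ +] fE.
  rewrite -fE evu; case/orP=> [/set0Pn[t] | /oppositeP[a [b [z [w [eab fzw bz wa]]]]]].
    rewrite !inE => /andP[/pred2P[] -> /pred2P[] tE].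
    - by rewrite tE eqxx in yv.
    - by rewrite -tE adj_sym.
    - by rewrite tE eqxx in yu.
    - by have := indep y u yN uN; rewrite tE yx.
  have yuF : adj y u = false by apply/negbTE/indep.
  case: (set2_inj eab) (set2_inj fzw) => -[? ?] [] [? ?]; subst=> //.
  - by rewrite adj_sym yuF in bz.
  - by rewrite adj_sym.
  - by rewrite yuF in wa.
(* Both neighborhoods have [D] elements, so the inclusion is an equality. *)
have eqN y : y \in N -> nbhd y = nbhd u.
  move=> yN; apply/eqP; rewrite eqEcard sub //=.
  by have := degN _ yN; have := degN _ uN; rewrite /deg => -> ->.
exists N; split=> [|y /degN // | y z yN zN]; first by rewrite Nd.
by rewrite !eqN.
Qed.

(** The two alternatives for [k] serve the general bound and the saving of one color in the absence
    of twins. *)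
Lemma degenerate_colorable (G : sgraph) d D k : 0 < D -> degenerate d G -> max_deg G <= D ->
  d * D <= k \/ d * D <= k.+1 /\ ~ twins_of_degree G d D -> B_colorable G k.
Proof.
move=> D_gt0 dG maxD kP.
have [|c cP] := @greedy_coloring _ _ k (@conflict_sym G) (@conflict_irr G).
  move=> A /(degenerate_conflict D_gt0 dG maxD)[e eA [ltm mtwins]]; exists e => //.
  case: kP => [/(leq_trans ltm) // | [lek noTwins]].
  rewrite ltnNge; apply/negP=> lekm; apply: noTwins; apply: mtwins.
  exact: leq_trans lek _.
by apply/existsP; exists c; apply: conflict_B_coloring.
Qed.

(** * Copies of complete bipartite graphs *)

Lemma copy_embedding (G : sgraph) a b : contains_copy G (Kab a b) ->
  exists (l : 'I_a -> G) (r : 'I_b -> G),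
    [/\ injective l, injective r & forall i j, adj (l i) (r j)].
Proof.
case=> H [phi [phi_inj _ phi_adj]]; exists (phi \o inl), (phi \o inr); split.
- by move=> i j /phi_inj[].
- by move=> i j /phi_inj[].
- by move=> i j; apply: (@sub_adj_adj _ H); rewrite phi_adj.
Qed.

(** Any two distinct edges of the copy meet or lie on a common 4-cycle, so a B-coloring is injective
    on its [a * b] edges. *)
Lemma copy_lower_bound (G : sgraph) a b : contains_copy G (Kab a b) -> a * b <= qB G.
Proof.
case/copy_embedding=> l [r [linj rinj lr]].
have lNr i j : l i != r j by apply: adj_neq.
have /existsP[c /andP[/forallP proper /forallP rainbow]] := qB_colorable G.
pose g (p : 'I_a * 'I_b) : edge G := Sub [set l p.1; r p.2] (adj_edge_set (lr p.1 p.2)).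
have gE p : val (g p) = [set l p.1; r p.2] by [].
suff cg_inj : injective (c \o g).
  by have := leq_card _ cg_inj; rewrite card_prod !card_ord.
have meets p q x : p != q -> g p != g q -> x \in val (g p) -> x \in val (g q) ->
    c (g p) <> c (g q).
  move=> pq gpq xp xq; apply/eqP.
  have /forallP/(_ (g q))/implyP := proper (g p); apply; rewrite gpq /=.
  by apply/set0Pn; exists x; rewrite inE xp.
move=> [i j] [i' j'] /=; have [// | npq] := eqVneq (i, j) (i', j').
have gpq : g (i, j) != g (i', j').
  rewrite -(inj_eq val_inj) !gE /=; apply: contraNneq npq => /set2_inj[] [].
    by move=> /linj-> /rinj->.
  by move=> /eqP; rewrite (negPf (lNr _ _)).
have [ii | ii] := eqVneq i i'.
  by move/(meets _ _ (l i)); case=> //; rewrite gE ?ii !inE eqxx.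
have [jj | jj] := eqVneq j j'.
  by move/(meets _ _ (r j)); case=> //; rewrite gE ?jj !inE eqxx orbT.
move=> cE; suff : c (g (i, j)) != c (g (i', j')) by rewrite cE eqxx.
(* Disjoint edges of the copy are opposite in the 4-cycle through their four ends. *)
have cycle : is_cycle4 (l i) (r j) (l i') (r j').
  by rewrite /is_cycle4 /= !inE !negb_or !lNr (inj_eq linj) ii (inj_eq rinj) jj
    !lr [adj (r _) _]adj_sym !lr [adj (r _) _]adj_sym !lr eq_sym lNr.
have /forallP/(_ (r j))/forallP/(_ (l i'))/forallP/(_ (r j'))/implyP := rainbow (l i).
move/(_ cycle)/forallP/(_ (g (i, j)))/forallP/(_ (g (i', j')))/implyP; apply.
by rewrite gpq !gE /cycle4_edges /= !inE !eqxx ?orbT.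
Qed.

(** The [b] right vertices already fill the neighborhood of each left vertex, whose degree is at
    most [b]. *)
Lemma copy_twins (G : sgraph) a b : max_deg G <= b ->
  contains_copy G (Kab a b) -> twins_of_degree G a b.
Proof.
move=> maxb /copy_embedding[l [r [linj rinj lr]]].
have nbhdE i : nbhd (l i) = [set r j | j in 'I_b].
  apply/esym/eqP; rewrite eqEcard card_imset // card_ord.
  rewrite (leq_trans (deg_leq_max (l i)) maxb) andbT.
  by apply/subsetP=> _ /imsetP[j _ ->]; rewrite inE.
exists [set l i | i in 'I_a]; split.
- by rewrite card_imset // card_ord.
- by move=> _ /imsetP[i _ ->]; rewrite /deg nbhdE card_imset // card_ord.
- by move=> _ _ /imsetP[i _ ->] /imsetP[j _ ->]; rewrite !nbhdE.
Qed.

Lemma embedding_copy (G : sgraph) a b (l : 'I_a -> G) (r : 'I_b -> G) :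
  injective l -> injective r -> (forall i j, adj (l i) (r j)) ->
  contains_copy G (Kab a b).
Proof.
move=> linj rinj lr.
pose phi (x : Kab a b) := match x with inl i => l i | inr j => r j end.
have phi_inj : injective phi.
  move=> [i|i] [j|j] //= eqij; try by rewrite ?(linj _ _ eqij) ?(rinj _ _ eqij).
    by have := adj_neq (lr i j); rewrite eqij eqxx.
  by have := adj_neq (lr j i); rewrite eqij eqxx.
have phi_adj x y : adj x y -> adj (phi x) (phi y).
  by case: x y => i [] j //= _; rewrite // adj_sym.
(* The copy need not be induced: the subgraph keeps only the images of edges of [Kab a b]. *)
pose h (u v : G) := [exists x, exists y, [&& phi x == u, phi y == v & adj x y]].
have hP u v : reflect (exists x y, [/\ phi x = u, phi y = v & adj x y]) (h u v).
  apply: (iffP existsP) => [[x /existsP[y /and3P[/eqP ? /eqP ? ?]]]|[x [y [<- <- xy]]]].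
    by exists x, y.
  by exists x; apply/existsP; exists y; rewrite !eqxx.
have hsym : symmetric h.
  have imp u v : h u v -> h v u.
    by move/hP=> [x [y [xu yv xy]]]; apply/hP; exists y, x; rewrite adj_sym.
  by move=> u v; apply/idP/idP; apply: imp.
have hadj u v : h u v -> adj u v by move/hP=> [x [y [<- <- /phi_adj]]].
have hvert u v : h u v -> u \in phi @: [set: Kab a b].
  by move/hP=> [x [y [<- _ _]]]; apply: imset_f.
exists (Subgraph hsym hadj hvert), phi; split=> // x y /=.
apply/hP/idP => [[x' [y' [/phi_inj-> /phi_inj->]]] // | xy]; by exists x, y.
Qed.

Lemma twins_copy (G : sgraph) a b : 0 < a ->
  twins_of_degree G a b -> contains_copy G (Kab a b).
Proof.
move=> a_gt0 [S [leS degS nbhdS]].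
(* The left side consists of [a] elements of [S]; the right side is their common neighborhood, read
   off at [x0]. *)
pose l (i : 'I_a) := enum_val (widen_ord leS i).
have lS i : l i \in S by apply: enum_valP.
pose x0 := l (Ordinal a_gt0).
have cardx0 : b = #|nbhd x0| by apply/esym/degS/lS.
pose r (j : 'I_b) := enum_val (cast_ord cardx0 j).
apply: (@embedding_copy _ _ _ l r).
- by move=> i j /enum_val_inj/(congr1 val) /= /val_inj.
- by move=> i j /enum_val_inj/cast_ord_inj.
- move=> i j; have rj : r j \in nbhd x0 by apply: enum_valP.
  by move: rj; rewrite (nbhdS _ _ (lS _) (lS i)) inE.
Qed.

(** * The extremal graph *)

Lemma Kab_copy a b : contains_copy (Kab a b) (Kab a b).
Proof. by apply: (@embedding_copy (Kab a b) a b inl inr) => // i j []. Qed.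

Lemma nbhd_Kab_inl a b i : nbhd (inl i : Kab a b) = inr @: [set: 'I_b].
Proof.
apply/setP=> -[j|j]; rewrite inE /=; first by apply/esym/negbTE/imsetP=> -[].
by rewrite imset_f.
Qed.

Lemma nbhd_Kab_inr a b i : nbhd (inr i : Kab a b) = inl @: [set: 'I_a].
Proof.
apply/setP=> -[j|j]; rewrite inE /=; last by apply/esym/negbTE/imsetP=> -[].
by rewrite imset_f.
Qed.

Lemma deg_Kab_inl a b i : deg (inl i : Kab a b) = b.
Proof. by rewrite /deg nbhd_Kab_inl card_imset ?cardsT ?card_ord // => ? ? []. Qed.

Lemma deg_Kab_inr a b i : deg (inr i : Kab a b) = a.
Proof. by rewrite /deg nbhd_Kab_inr card_imset ?cardsT ?card_ord // => ? ? []. Qed.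

Lemma max_deg_Kab a b : a <= b -> max_deg (Kab a b) <= b.
Proof.
by move=> ab; apply/bigmax_leqP=> -[i|i] _; rewrite ?deg_Kab_inl ?deg_Kab_inr.
Qed.

(** A subgraph with a right vertex has there a degree of at most [a]; without right vertices it has
    no edges. *)
Lemma degenerate_Kab a b : degenerate a (Kab a b).
Proof.
move=> H /set0Pn[x xH].
have [/existsP[j jH] | noR] := boolP [exists j, inr j \in sub_vert H].
  exists (inr j) => //; rewrite -[X in _ <= X](deg_Kab_inr a j).
  by apply: subset_leq_card; apply/subsetP=> y; rewrite !inE; apply: sub_adj_adj.
exists x => //; rewrite /sub_deg (_ : [set _ | _] = set0) ?cards0 //.
apply/setP=> y; rewrite !inE; apply/negP=> xy; case/negP: noR; apply/existsP.
have := sub_adj_adj xy; have := xy; rewrite sub_adj_sym => /sub_adj_vert yH.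
by case: x y xH yH {xy} => i [] j // xH yH _; [exists j | exists i].
Qed.

(** * Bound, sharpness and equivalence *)

(** A search over the finitely many vertex sets gives this case split without classical axioms. *)
Lemma twins_dec (G : sgraph) d D :
  twins_of_degree G d D \/ ~ twins_of_degree G d D.
Proof.
pose t := [exists S : {set G}, [&& d <= #|S|, [forall x in S, deg x == D]
  & [forall x in S, [forall y in S, nbhd x == nbhd y]]]].
have tP : reflect (twins_of_degree G d D) t.
  apply: (iffP existsP) => -[S].
    case/and3P=> dS /forall_inP degS /forall_inP nbS.
    exists S; split=> // [x /degS/eqP // | x y /nbS/forall_inP nb yS].
    exact/eqP/nb.
  move=> [dS degS nbS]; exists S; rewrite dS /=; apply/andP; split.
    by apply/forall_inP=> x /degS->.
  by apply/forall_inP=> x xS; apply/forall_inP=> y yS; apply/eqP/nbS.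
by case: tP; [left | right].
Qed.

Theorem corollary2p3 (d D : nat) (hd : 1 <= d) (hdD : d <= D) :
  [/\ exists G : sgraph,
        [/\ degenerate d G, max_deg G <= D & qB G = d * D],
      forall G : sgraph,
        degenerate d G -> max_deg G <= D -> qB G <= d * D
    & forall G : sgraph,
        degenerate d G -> max_deg G <= D ->
        (qB G = d * D <-> contains_copy G (Kab d D)) /\
        (contains_copy G (Kab d D) <-> twins_of_degree G d D)].
Proof.
have D_gt0 : 0 < D by apply: leq_trans hdD.
have upper G : degenerate d G -> max_deg G <= D -> qB G <= d * D.
  by move=> dG maxD; apply: qB_leq; apply: (degenerate_colorable D_gt0 dG maxD); left.
have copy_qB G : degenerate d G -> max_deg G <= D ->
    contains_copy G (Kab d D) -> qB G = d * D.
  move=> dG maxD copy; apply/eqP.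
  by rewrite eqn_leq upper //= copy_lower_bound.
split=> // [|G dG maxD].
  exists (Kab d D); have [? ?] := (@degenerate_Kab d D, max_deg_Kab hdD).
  by split=> //; apply: copy_qB => //; apply: Kab_copy.
have twinsE : contains_copy G (Kab d D) <-> twins_of_degree G d D.
  by split; [apply: copy_twins | apply: twins_copy].
split=> //; split=> [qE|]; last exact: copy_qB.
(* Positivity makes [(d * D).-1] strictly smaller than [d * D], so coloring a twin-free graph with
   that many colors contradicts [qE]. *)
have dD_gt0 : 0 < d * D by rewrite muln_gt0 hd.
have [/twinsE // | noTwins] := twins_dec G d D.
suff : qB G <= (d * D).-1 by rewrite qE leqNgt prednK ?leqnn.
apply: qB_leq; apply: (degenerate_colorable D_gt0 dG maxD).
by right; rewrite prednK.
Qed.
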